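(* Let $N,M,R\in\mathbb{N}$ and suppose that $\cos(\theta^{1}_{R,N})>0$ and $\cos(\theta^{2}_{N,M})>0$. Then $$\|f^{\dagger}-f^{\delta}_{N,M,R}\|_{\mathsf{X}}\le\bigl(1+2\sec(\theta^2_{N,M})\bigr)\|f^{\dagger}-f\|_{\mathsf{X}}+\sec(\theta^2_{N,M})\|f^{\dagger}-\mathcal{P}_{\mathsf{T}_M}f^{\dagger}\|_{\mathsf{X}}+\sec(\theta^2_{N,M})\sec(\theta^1_{R,N})\Bigl(\|f-\mathcal{P}_{\mathsf{V}_N}f\|_{\mathsf{X}}+\frac{\delta}{\sigma_N}\Bigr).$$
   Context: Let $\mathsf{X},\mathsf{Y}$ be separable complex Hilbert spaces and $\mathcal{A}:\mathsf{X}\to\mathsf{Y}$ a compact bounded linear operator with singular system $\{\sigma_k,v_k,u_k\}_{k\in\mathbb{N}}$: $\sigma_1\ge\sigma_2\ge\dots>0$, $\{v_k\}$ is an orthonormal basis of $\mathsf{V}:=N(\mathcal{A})^{\perp}$, $\{u_k\}$ is an orthonormal basis of $\mathsf{U}:=N(\mathcal{A}^* )^{\perp}$, $\mathcal{A}v_k=\sigma_ku_k$, $\mathcal{A}^*u_k=\sigma_kv_k$ ($N(\cdot)$ denotes the null space). Put $\mathsf{V}_N=\mathrm{span}\{v_1,\dots,v_N\}$, $\mathsf{U}_N=\mathrm{span}\{u_1,\dots,u_N\}$. Let $\{\psi_k\}_{k\in\mathbb{N}}$ be a frame for $\mathsf{S}:=N(\mathcal{A}^* )^{\perp}=\mathsf{U}$,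 $\{\varphi_k\}_{k\in\mathbb{N}}$ a frame for $\mathsf{T}:=N(\mathcal{A})^{\perp}=\mathsf{V}$, and $\mathsf{T}_M:=\mathrm{span}\{\varphi_1,\dots,\varphi_M\}$. $\mathcal{P}_{\mathsf{W}}$ denotes the orthogonal projection onto a closed subspace $\mathsf{W}$. Let $f\in\mathsf{X}$, $g=\mathcal{A}f$, $f^{\dagger}:=\mathcal{A}^{\dagger}g$ ($\dagger$ on an operator denotes the Moore–Penrose generalized inverse), and let noisy data $g^{\delta}=g+z$ with $z\in\mathsf{Y}$, $\|z\|_{\mathsf{Y}}\le\delta$, be given. Let $T_M\beta=\sum_{j=1}^M\beta_j\varphi_j$ ($\beta\in\mathbb{C}^M$); $V_N\beta=\sum_{k=1}^N\beta_kv_k$, $U_N\beta=\sum_{k=1}^N\beta_ku_k$ ($\beta\in\mathbb{C}^N$); $S_R\beta=\sum_{j=1}^R\beta_j\psi_j$ ($\beta\in\mathbb{C}^R$); $\Sigma_N=\mathrm{diag}(\sigma_1,\dots,\sigma_N)$. Define $$g^{\delta}_{N,R}=U_N(U_N^*S_RS_R^*U_N)^{-1}U_N^*S_RS_R^*g^{\delta},\qquad f^{\delta}_{N,M,R}=T_M(T_M^*V_NV_N^*T_M)^{\dagger}T_M^*V_N\Sigma_N^{-1}U_N^*g^{\delta}_{N,R}.$$ For closed subspaces $\mathsf{W}_1,\mathsf{W}_2$ the subspace angle $\theta_{\mathsf{W}_1,\mathsf{W}_2}\in[0,\pi/2]$ is defined by $\cos\theta_{\mathsf{W}_1,\mathsf{W}_2}=\inf_{w\in\mathsf{W}_1,\|w\|=1}\|\mathcal{P}_{\mathsf{W}_2}w\|$.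 With $\mathcal{S}_Rh=\sum_{j=1}^R\langle h,\psi_j\rangle\psi_j$ on $\mathsf{Y}$, put $\theta^{1}_{R,N}:=\theta_{\mathsf{U}_N,\,\mathcal{S}_R(\mathsf{U}_N)}$ and $\theta^{2}_{N,M}:=\theta_{\mathsf{T}_M,\,\mathcal{P}_{\mathsf{V}_N}(\mathsf{T}_M)}$. *)

(* Defs.v *)
From HB Require Import structures.
From mathcomp Require Import all_boot all_order all_algebra.
From mathcomp Require Import complex.
From mathcomp Require Import all_classical all_reals all_analysis.
Set Implicit Arguments.
Unset Strict Implicit.
Unset Printing Implicit Defensive.
Import Order.TTheory GRing.Theory Num.Theory Num.Def.
Import numFieldNormedType.Exports.
Local Open Scope classical_set_scope.
Local Open Scope ring_scope.
Local Open Scope complex_scope.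

(* Inner products are the positive definite forms {dot U for conjC}: linear in
   the first argument, conjugate-linear in the second. *)

Section InnerProductSpaces.
Context {K : realType}.
Local Notation C := K[i].

(* The library norm on a complex normed space takes its values in K[i]; they
   are real and nonnegative, so taking the real part loses nothing. *)
Definition rnorm (V : normedZmodType C) (x : V) : K := complex.Re `|x|.

Definition is_norm_of (V : normedModType C) (d : {dot V for conjC}) : Prop :=
  forall x : V, `|x| ^+ 2 = d x x.

Definition separable_space (T : topologicalType) : Prop :=
  exists2 D : set T, countable D & dense D.

Definition nullsp (U V : lmodType C) (L : U -> V) : set U := [set x | L x = 0].

Definition orth_compl (U : lmodType C) (d : {dot U for conjC}) (W : set U)
  : set U :=
  [set x | forall w, W w -> d x w = 0].

(* The orthogonal projection onto W; the value 0 is only used where x has no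
   decomposition along W and its orthogonal complement. *)
Definition orth_proj (U : lmodType C) (d : {dot U for conjC}) (W : set U)
    (x : U) : U :=
  xget 0 [set p | W p /\ orth_compl d W (x - p)].

(* The value 0 is only used where the functional z |-> <L z, y> is not
   represented by a vector. *)
Definition adjoint_op (U V : lmodType C) (dU : {dot U for conjC})
    (dV : {dot V for conjC}) (L : U -> V) (y : V) : U :=
  xget 0 [set x | forall z, dV (L z) y = dU z x].

(* The linear extension of the inverse of L : N(L)^perp -> range(L) to
   range(L) + range(L)^perp that vanishes on range(L)^perp; outside of this
   domain the value is 0. *)
Definition moore_penrose (U V : lmodType C) (dU : {dot U for conjC})
    (dV : {dot V for conjC}) (L : U -> V) (y : V) : U :=
  xget 0 [set x | orth_compl dU (nullsp L) x /\
                  orth_compl dV (range L) (y - L x)].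

Definition synth (U : lmodType C) (w : nat -> U) (n : nat) (b : 'rV[C]_n) : U :=
  \sum_(k < n) b 0 k *: w k.

(* The Euclidean inner product \sum_k a_k b_k^* of C^n. *)
Definition dotC (n : nat) : {dot 'rV[C]_n for conjC} := @dotmx _ n.

Definition synth_adj (U : lmodType C) (d : {dot U for conjC}) (w : nat -> U)
    (n : nat) : U -> 'rV[C]_n :=
  adjoint_op (dotC n) d (synth w (n := n)).

Definition spanN (U : lmodType C) (w : nat -> U) (n : nat) : set U :=
  range (synth w (n := n)).

Definition orthonormal_basis (V : normedModType C) (d : {dot V for conjC})
    (W : set V) (e : nat -> V) : Prop :=
  (forall i j, d (e i) (e j) = (i == j)%:R) /\
  closure (\bigcup_n spanN e n) = W.

Definition is_frame (V : normedModType C) (d : {dot V for conjC})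
    (W : set V) (w : nat -> V) : Prop :=
  (forall k, W (w k)) /\
  exists a b : K, [/\ 0 < a, a <= b & forall h, W h ->
    ((a * rnorm h ^+ 2)%:E <= \sum_(0 <= k <oo) (rnorm (d h (w k)) ^+ 2)%:E
       <= (b * rnorm h ^+ 2)%:E)%E].

(* The infimum is taken in [0, 1]; adjoining 1 matters only when W1 = {0}, in
   which case the angle is 0. *)
Definition subspace_angle (V : normedModType C) (d : {dot V for conjC})
    (W1 W2 : set V) : K :=
  acos (inf (1 |` [set rnorm (orth_proj d W2 w) | w in
                    [set w | W1 w /\ rnorm w = 1]])).

Definition sec (x : K) : K := (cos x)^-1.

Definition bounded_operator (X Y : normedModType C) (A : X -> Y) : Prop :=
  exists B : K, forall x, rnorm (A x) <= B * rnorm x.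

Definition compact_operator (X Y : normedModType C) (A : X -> Y) : Prop :=
  precompact (A @` [set x | rnorm x <= 1]).

(* Indices are shifted: sigma k, v k, u k stand for sigma_(k+1), v_(k+1),
   u_(k+1), and likewise for the frames. *)
Definition singular_system (X Y : normedModType C) (dX : {dot X for conjC})
    (dY : {dot Y for conjC}) (A : X -> Y)
    (sigma : nat -> K) (v : nat -> X) (u : nat -> Y) : Prop :=
  [/\ (forall k, 0 < sigma k /\ sigma k.+1 <= sigma k),
      orthonormal_basis dX (orth_compl dX (nullsp A)) v,
      orthonormal_basis dY (orth_compl dY (nullsp (adjoint_op dX dY A))) u,
      (forall k, A (v k) = (sigma k)%:C *: u k) &
      (forall k, adjoint_op dX dY A (u k) = (sigma k)%:C *: v k)].

Definition frame_op (Y : lmodType C) (dY : {dot Y for conjC})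
    (psi : nat -> Y) (R : nat) (h : Y) : Y :=
  \sum_(j < R) dY h (psi j) *: psi j.

(* Vectors of C^n are rows: the matrix lin1_mx L of L acts on the right. *)
Definition op_inv (n : nat) (L : 'rV[C]_n -> 'rV[C]_n) (b : 'rV[C]_n)
  : 'rV[C]_n := b *m invmx (lin1_mx L).

Definition Sigma_mx (sigma : nat -> K) (N : nat) : 'M[C]_N :=
  diag_mx (\row_(k < N) (sigma k)%:C).

Definition g_rec (Y : lmodType C) (dY : {dot Y for conjC}) (u psi : nat -> Y)
    (N R : nat) (y : Y) : Y :=
  let U := synth u (n := N) in let Us := synth_adj dY u N in
  let S := synth psi (n := R) in let Ss := synth_adj dY psi R in
  U (op_inv (Us \o S \o Ss \o U) (Us (S (Ss y)))).

Definition f_rec (X Y : lmodType C) (dX : {dot X for conjC})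
    (dY : {dot Y for conjC}) (sigma : nat -> K) (v phi : nat -> X)
    (u psi : nat -> Y) (N M R : nat) (y : Y) : X :=
  let V := synth v (n := N) in let Vs := synth_adj dX v N in
  let T := synth phi (n := M) in let Ts := synth_adj dX phi M in
  let Us := synth_adj dY u N in
  T (moore_penrose (dotC M) (dotC M) (Ts \o V \o Vs \o T)
      (Ts (V (Us (g_rec dY u psi N R y) *m invmx (Sigma_mx sigma N))))).

End InnerProductSpaces.

(* Main.v *)
Require Import Defs.
From HB Require Import structures.
From mathcomp Require Import all_boot all_order all_algebra.
From mathcomp Require Import complex.
From mathcomp Require Import all_classical all_reals all_analysis.
From mathcomp Require Import ring lra.
Import Order.TTheory GRing.Theory Num.Theory Num.Def.
Import numFieldNormedType.Exports.
Local Open Scope classical_set_scope.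
Local Open Scope ring_scope.
Local Open Scope complex_scope.

Set Implicit Arguments.
Unset Strict Implicit.
Unset Printing Implicit Defensive.

(** Both stages of the reconstruction are oblique projections, and each one is
controlled by the angle in its own stability constant.

The vector w = g_rec y lies in U_N and satisfies y - w _|_ S_R(U_N)
([g_rec_spec]); the vector t = f_rec y lies in T_M and satisfies
V b - t _|_ P(T_M), where P is the orthogonal projection onto V_N and b are the
coefficients Sigma_N^-1 U_N^* w ([frame_rec_spec]).  For a vector w of W1 such
that y - w _|_ W2 the orthogonal projections of w and y onto W2 agree, so
cos(theta_(W1,W2)) |w| <= |P_W2 w| = |P_W2 y| <= |y| ([cos_angle_le]); this bounds
both oblique projections by the secant of the angle.

For the second stage, let x be the target and t' in T_M the oblique projection
of P x.  Then |x - t| <= |x - t'| + |t' - t|; the second term is at most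
sec(theta2) |P x - V b|, and the first one is at most sec(theta2) times the
distance from x to any vector of T_M ([oblique_residual_le]): the secant bounds an
oblique projection and its complement alike.  This gives [frame_rec_error].

It remains to bound P f - V b.  Since A P f = U_N U_N^* A f, the error of the
first stage is at most sec(theta1) |A (f - P f) + z|, and |A h| <= sigma_N |h|
for h = f - P f, which is orthogonal to v_1, ..., v_N ([singular_tail_le]).
Applying Sigma_N^-1 costs the factor 1 / sigma_N ([singular_coef_error]).
The bound on A h is where completeness enters: h is split along the closed
subspace N(A) and its complement ([closed_subspace_decomposition]), and the second
component is approximated by finite combinations of the singular vectors. *)

(** * Inner products and norms *)

Section Dot.
Context {K : realType} {U : lmodType K[i]} (d : {dot U for conjC}).
Lemma dotBl x y z : d (x - y) z = d x z - d y z. Proof. exact: linearBl. Qed.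

Lemma dotDl x y z : d (x + y) z = d x z + d y z. Proof. exact: linearDl. Qed.

Lemma dotBr x y z : d z (x - y) = d z x - d z y. Proof. exact: linearBr. Qed.

Lemma dotDr x y z : d z (x + y) = d z x + d z y. Proof. exact: linearDr. Qed.

Lemma dotZl a x z : d (a *: x) z = a * d x z. Proof. exact: linearZl_LR. Qed.

Lemma dotZr a x z : d z (a *: x) = conjC a * d z x. Proof. exact: linearZr_LR. Qed.

Lemma dot_suml n (F : 'I_n -> U) z : d (\sum_i F i) z = \sum_i d (F i) z.
Proof. exact: linear_sumlz. Qed.

Lemma dot_sumr n (F : 'I_n -> U) z : d z (\sum_i F i) = \sum_i d z (F i).
Proof. exact: linear_sumr. Qed.

Lemma dot0l z : d 0 z = 0. Proof. exact: linear0l. Qed.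

Lemma dot0r z : d z 0 = 0. Proof. exact: linear0r. Qed.

Lemma dotC_sym x y : d x y = conjC (d y x).
Proof. by rewrite hermC /= expr0 mul1r. Qed.
End Dot.

Section Norm.
Context {K : realType} {V : normedZmodType K[i]}.
Lemma rnorm_ge0 (x : V) : 0 <= rnorm x.
Proof. by rewrite /rnorm; have := normr_ge0 x; rewrite lecE /= => /andP[_]. Qed.

Lemma rnormE (x : V) : `|x| = (rnorm x)%:C.
Proof. by rewrite /rnorm RRe_real// ger0_real. Qed.

Lemma rnormD (x y : V) : rnorm (x + y) <= rnorm x + rnorm y.
Proof. by rewrite -lecR rmorphD /= -!rnormE ler_normD. Qed.

Lemma rnormB (x y : V) : rnorm (x - y) = rnorm (y - x).
Proof. by rewrite /rnorm distrC. Qed.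

Lemma rnorm0 : rnorm (0:V) = 0.
Proof. by rewrite /rnorm normr0. Qed.

Lemma rnorm_eq0 (x : V) : rnorm x = 0 -> x = 0.
Proof. by move=> x0; apply/normr0_eq0; rewrite rnormE x0. Qed.
End Norm.

Section InnerProductNorm.
Context {K : realType} {V : normedModType K[i]} (d : {dot V for conjC}).
Hypothesis nd : is_norm_of d.

Lemma rnormZ (a : K) (x : V) : 0 <= a -> rnorm (a%:C *: x) = a * rnorm x.
Proof.
by move=> a0; apply: (@complexI K); rewrite -rnormE normrZ rmorphM /= -rnormE
  ger0_norm // lecR.
Qed.

Lemma dot_rnorm x : d x x = (rnorm x ^+ 2)%:C.
Proof. by rewrite -nd rnormE rmorphXn. Qed.

Lemma rnormD_sq (x y : V) :
  rnorm (x + y) ^+ 2 = rnorm x ^+ 2 + rnorm y ^+ 2 + 2 * complex.Re (d x y).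
Proof.
apply: (@complexI K); rewrite -(dot_rnorm) dnormD !rmorphD !(dot_rnorm).
congr (_ + _); rewrite rmorphM /= complexRe ReE mulrC rmorph_nat.
by rewrite mulfVK // pnatr_eq0.
Qed.

Lemma pythagoras (x y : V) : d x y = 0 ->
  rnorm (x + y) ^+ 2 = rnorm x ^+ 2 + rnorm y ^+ 2.
Proof. by move=> xy; rewrite rnormD_sq xy /= mulr0 addr0. Qed.

(** Subtracting from x its component along y leaves |x|^2 - |<x, y>|^2 / |y|^2;
stated without division, so that y = 0 is covered. The Cauchy-Schwarz inequality
is the nonnegativity of the left-hand side. *)
Lemma rnorm_residual (x y : V) :
  rnorm (x - (d x y / d y y) *: y) ^+ 2 * rnorm y ^+ 2 =
  rnorm x ^+ 2 * rnorm y ^+ 2 - rnorm (d x y) ^+ 2.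
Proof.
have [->|y0] := eqVneq y 0.
  by rewrite dot0r !rnorm0 !expr0n /= !mulr0 subrr.
apply: (@complexI K); rewrite rmorphB !(rmorphM _ (rnorm _ ^+ 2) (rnorm y ^+ 2)) /=.
rewrite -!(dot_rnorm) rmorphXn /= -rnormE normCK.
have yy : d y y != 0 by rewrite dnorm_eq0.
rewrite dotBl dotZl dotBr dotZr.
have -> : d y (x - (d x y / d y y) *: y) =
    conjC (d x y) - conjC (d x y / d y y) * d y y.
  by rewrite dotBr dotZr -dotC_sym.
have -> : conjC (d x y / d y y) = conjC (d x y) / d y y.
  by rewrite rmorphM /= fmorphV /= -(dotC_sym d y y).
by field.
Qed.

Lemma cauchy_schwarz (x y : V) : rnorm (d x y) <= rnorm x * rnorm y.
Proof.
rewrite -(@ler_pXn2r _ 2) ?nnegrE ?mulr_ge0 ?rnorm_ge0 //.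
by rewrite exprMn -subr_ge0 -rnorm_residual mulr_ge0 // exprn_ge0 // rnorm_ge0.
Qed.

Lemma rnorm_ge_Re (c : K[i]) : `|complex.Re c| <= rnorm c.
Proof. by rewrite -lecR -rnormE normc_ge_Re. Qed.

Lemma Re_dot_le (x y : V) : `|complex.Re (d x y)| <= rnorm x * rnorm y.
Proof. exact: le_trans (rnorm_ge_Re _) (cauchy_schwarz _ _). Qed.
End InnerProductNorm.

(** * Orthogonal projections and angles *)

Definition is_subspace {K : realType} {U : lmodType K[i]} (W : set U) : Prop :=
  W 0 /\ forall a x y, W x -> W y -> W (a *: x + y).

Section Subspace.
Context {K : realType} {U : lmodType K[i]} (W : set U).
Hypothesis sW : is_subspace W.
Lemma subspaceZ a x : W x -> W (a *: x).
Proof. by move=> Wx; rewrite -[_ *: _]addr0; apply: sW.2 => //; exact: sW.1. Qed.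

Lemma subspaceD x y : W x -> W y -> W (x + y).
Proof. by move=> Wx Wy; rewrite -[x]scale1r; apply: sW.2. Qed.

Lemma subspaceB x y : W x -> W y -> W (x - y).
Proof. by move=> Wx Wy; rewrite -scaleN1r addrC; apply: sW.2. Qed.
End Subspace.

Section Angle.
Context {K : realType} {V : normedModType K[i]} (d : {dot V for conjC}).
Hypothesis nd : is_norm_of d.

Lemma orth_proj_cases (U : lmodType K[i])
    (dU : {dot U for conjC}) (W : set U) (x : U) :
  let p := orth_proj dU W x in
  p = 0 \/ W p /\ orth_compl dU W (x - p).
Proof. by rewrite /= /orth_proj; case: xgetP => [p _ /= h|_]; [right|left]. Qed.

Lemma orth_proj_eq (U : lmodType K[i])
    (dU : {dot U for conjC}) (W : set U) (x p : U) :
  is_subspace W -> W p -> orth_compl dU W (x - p) -> orth_proj dU W x = p.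
Proof.
move=> sW Wp xp; rewrite /orth_proj; case: xgetP => [q _ /= [Wq xq]|/(_ p)];
  last by case.
have Wpq := subspaceB sW Wp Wq.
apply/esym/eqP; rewrite -subr_eq0 -(dnorm_eq0 dU).
have {1}-> : p - q = (x - q) - (x - p) by rewrite opprB [RHS]addrC addrA subrK.
by rewrite dotBl xq // xp // subrr.
Qed.

(** After scaling w to a unit vector, cos theta is at most the norm of
[orth_proj d W2 w]. If this vector is a genuine projection p, then y - w _|_ W2
makes it the projection of y too, whence |p| <= |y|; if w has no projection onto
W2, the default value 0 makes the bound trivial. *)
Lemma cos_angle_le (W1 W2 : set V) (w y : V) : is_subspace W1 -> W1 w ->
  orth_compl d W2 (y - w) -> cos (subspace_angle d W1 W2) * rnorm w <= rnorm y.
Proof.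
move=> sW1 Ww yw; have [w0|w0] := eqVneq (rnorm w) 0.
  by rewrite w0 mulr0 rnorm_ge0.
have w_gt0 : 0 < rnorm w by rewrite lt_def w0 rnorm_ge0.
set r := (rnorm w)^-1; have r0 : 0 <= r by rewrite invr_ge0 ltW.
rewrite -ler_pdivlMr // mulrC -/r -rnormZ //.
rewrite /subspace_angle; set S := (X in inf X).
have S0 : lbound S 0.
  by move=> _ [->//=|[x _ <-]]; rewrite rnorm_ge0.
have S1 : S 1 by left.
have le_S s : S s -> inf S <= s by apply: ge_inf; exists 0.
(* the infimum lies in [0, 1], so acos inverts cos there *)
rewrite acosK; last first.
  rewrite in_itv /= le_S // andbT.
  by apply: (le_trans _ (lb_le_inf (ex_intro _ _ S1) S0)); rewrite lerN10.
pose w' := r%:C *: w; pose y' := r%:C *: y.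
have yw' : orth_compl d W2 (y' - w').
  by move=> v W2v; rewrite -scalerBr dotZl yw // mulr0.
apply: (le_trans (le_S (rnorm (orth_proj d W2 w')) _)).
  right; exists w' => //; split; first exact: subspaceZ.
  by rewrite rnormZ // mulVf.
case: (orth_proj_cases d W2 w') => [->|]; first by rewrite rnorm0 rnorm_ge0.
move: (orth_proj d W2 w') => p [Wp wp].
have yp : d (y' - p) p = 0.
  have -> : y' - p = (y' - w') + (w' - p) by rewrite addrA subrK.
  by rewrite dotDl yw' // wp // addr0.
rewrite -(@ler_pXn2r _ 2) ?nnegrE ?rnorm_ge0 //.
have := pythagoras nd yp; rewrite subrK => y'E; rewrite -/y' y'E.
by rewrite lerDr exprn_ge0 // rnorm_ge0.
Qed.
End Angle.

(** * Finite-dimensional projections and the Moore-Penrose solution *)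

(** Existence of the least-squares solution, by a Gram-Schmidt step on the first
vector: y is w 0 made orthogonal to the other vectors, and a is the coefficient of
the residual along y. If y = 0 then a = 0, and the residual is already orthogonal
to w 0. *)
Lemma exists_normal_equations (K : realType) (U : lmodType K[i])
    (d : {dot U for conjC}) (n : nat) (w : 'I_n -> U) (x : U) :
  exists b : 'I_n -> K[i], forall j, d (x - \sum_i b i *: w i) (w j) = 0.
Proof.
elim: n w x => [|n IH] w x; first by exists (fun=> 0) => -[].
pose w' (i : 'I_n) := w (lift ord0 i).
have [b xb] := IH w' x; have [c yc] := IH w' (w ord0).
set e := x - _ in xb; set y := w ord0 - _ in yc; pose a := d e y / d y y.
exists (fun i => if unlift ord0 i is Some j then b j - a * c j else a).
set s := \sum_i _.
have -> : x - s = e - a *: y.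
  rewrite /s big_ord_recl unlift_none /e /y.
  under eq_bigr => i _ do rewrite liftK scalerBl -scalerA.
  rewrite sumrB -scaler_sumr scalerBr -!addrA; congr (_ + _).
  by rewrite !opprD !opprK addrCA addrC -!addrA.
have zj j : d (e - a *: y) (w' j) = 0 by rewrite dotBl dotZl xb yc mulr0 subrr.
have z0 : d (e - a *: y) y = 0.
  rewrite dotBl dotZl; have [->|y0] := eqVneq y 0.
    by rewrite !dot0r mulr0 subrr.
  by rewrite /a divfK ?subrr // dnorm_eq0.
move=> j; case: (unliftP ord0 j) => [i ->|->]; first exact: zj.
have -> : w ord0 = y + \sum_i c i *: w' i by rewrite subrK.
rewrite dotDr z0 add0r dot_sumr big1 // => i _.
by rewrite dotZr zj mulr0.
Qed.

Section Synthesis.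
Context {K : realType} {U : lmodType K[i]} (d : {dot U for conjC}) (w : nat -> U).

Lemma synth_linear n : linear (synth w (n := n)).
Proof.
move=> a b c; rewrite /synth scaler_sumr -big_split /=; apply: eq_bigr => i _.
by rewrite !mxE scalerDl scalerA.
Qed.

HB.instance Definition _ n :=
  GRing.isLinear.Build _ _ _ _ (synth w (n := n)) (@synth_linear n).

Lemma spanN_subspace n : is_subspace (spanN w n).
Proof.
split; first by exists 0 => //; rewrite linear0.
by move=> a _ _ [b _ <-] [c _ <-]; exists (a *: b + c) => //; rewrite linearP.
Qed.

Lemma dotCE n (b c : 'rV[K[i]]_n) : @dotC K n b c = \sum_k b 0 k * conjC (c 0 k).
Proof. by rewrite /dotC /= dotmxE mxE; apply: eq_bigr => k _; rewrite !mxE. Qed.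

Lemma dot_synth_row n (b : 'rV_n) y :
  d (synth w b) y = @dotC K n b (\row_k d y (w k)).
Proof.
rewrite dotCE /synth dot_suml; apply: eq_bigr => k _.
by rewrite dotZl mxE -dotC_sym.
Qed.

Lemma synth_adjE n y : synth_adj d w n y = \row_k d y (w k).
Proof.
rewrite /synth_adj /adjoint_op.
case: xgetP => [b _ h|/(_ (\row_k d y (w k))) h]; last first.
  by case: h => /= b; exact: dot_synth_row.
apply/eqP; rewrite -subr_eq0 -(dnorm_eq0 (@dotC K n)); set r := _ - _.
by rewrite {2}/r dotBr -(h : forall z, _ = @dotC K n z b) -dot_synth_row subrr.
Qed.

Lemma dot_synth n (b : 'rV_n) y :
  d (synth w b) y = @dotC K n b (synth_adj d w n y).
Proof. by rewrite synth_adjE dot_synth_row. Qed.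

Lemma dot_synthr n (b : 'rV_n) y :
  d y (synth w b) = @dotC K n (synth_adj d w n y) b.
Proof. by rewrite dotC_sym dot_synth -dotC_sym. Qed.

Lemma synth_adj_linear n : linear (synth_adj d w n).
Proof.
move=> a x y; rewrite !synth_adjE; apply/rowP => k.
by rewrite !mxE dotDl dotZl.
Qed.

HB.instance Definition _ n :=
  GRing.isLinear.Build _ _ _ _ (synth_adj d w n) (@synth_adj_linear n).

Lemma orth_spanN n y : synth_adj d w n y = 0 -> orth_compl d (spanN w n) y.
Proof. by move=> y0 _ [b _ <-]; rewrite dot_synthr y0 dot0l. Qed.

End Synthesis.

Section Orthonormal.
Context {K : realType} {U : lmodType K[i]} (d : {dot U for conjC}) (e : nat -> U).
Hypothesis on : forall i j, d (e i) (e j) = (i == j)%:R.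

Lemma synth_adjK n : cancel (synth e (n := n)) (synth_adj d e n).
Proof.
move=> b; rewrite synth_adjE; apply/rowP => k; rewrite mxE /synth dot_suml.
rewrite (bigD1 k) //= dotZl on eqxx mulr1 big1 ?addr0 // => i ik.
by rewrite dotZl on -val_eqE /= in ik *; rewrite (negPf ik) mulr0.
Qed.

Lemma orth_proj_spanN n x :
  orth_proj d (spanN e n) x = synth e (synth_adj d e n x).
Proof.
apply: orth_proj_eq; [exact: spanN_subspace|by eexists|].
by apply: orth_spanN; rewrite linearB /= synth_adjK subrr.
Qed.

Lemma orth_spanN_residual n x :
  orth_compl d (spanN e n) (x - synth e (synth_adj d e n x)).
Proof. by apply: orth_spanN; rewrite linearB /= synth_adjK subrr. Qed.
End Orthonormal.

Lemma linear_rowE (K : realType) (U : lmodType K[i]) n (L : 'rV[K[i]]_n -> U) :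
  linear L -> forall b, L b = \sum_i b 0 i *: L (delta_mx 0 i).
Proof.
move=> linL b.
pose f : {linear 'rV[K[i]]_n -> U} :=
  HB.pack L (GRing.isLinear.Build _ _ _ _ L linL).
rewrite -[L]/(f : _ -> _) {1}[b]row_sum_delta linear_sum.
by apply: eq_bigr => i _; rewrite linearZ.
Qed.

Lemma op_invK (K : realType) n (L : 'rV[K[i]]_n -> 'rV[K[i]]_n) :
  linear L -> (forall b, L b = 0 -> b = 0) -> forall b, L (op_inv L b) = b.
Proof.
move=> linL L0 b.
pose f : {linear 'rV[K[i]]_n -> 'rV[K[i]]_n} :=
  HB.pack L (GRing.isLinear.Build _ _ _ _ L linL).
have LE c : L c = c *m lin1_mx L by rewrite (mul_rV_lin1 f).
have u : lin1_mx L \in unitmx.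
  rewrite -row_free_unit -kermx_eq0; apply/eqP/row_matrixP => i.
  by rewrite row0; apply: L0; rewrite LE -row_mul mulmx_ker row0.
by rewrite LE /op_inv mulmxKV.
Qed.

(** Existence is the point, since the definition has a default value. Two
least-squares solutions give it: L c0 is the projection of b onto the range, and
L c1 the projection of c0. Self-adjointness makes the range orthogonal to the null
space, so L c1 is in N(L)^perp, and it makes c0 - L c1 a vector of N(L), so
L (L c1) = L c0. *)
Lemma moore_penrose_selfadjoint (K : realType) n (L : 'rV[K[i]]_n -> 'rV[K[i]]_n) :
  linear L -> (forall b c, @dotC K n (L b) c = @dotC K n b (L c)) ->
  forall b, orth_compl (@dotC K n) (range L)
    (b - L (moore_penrose (@dotC K n) (@dotC K n) L b)).
Proof.
move=> linL saL b.
have proj x : exists c, orth_compl (@dotC K n) (range L) (x - L c).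
  have [c xc] := exists_normal_equations (@dotC K n) (fun i => L (delta_mx 0 i)) x.
  exists (\row_i c i) => _ [a _ <-].
  rewrite (linear_rowE linL a) dot_sumr big1 // => i _.
  rewrite dotZr (linear_rowE linL (\row_i c i)).
  by under eq_bigr => j _ do rewrite mxE; rewrite xc mulr0.
rewrite /moore_penrose; case: xgetP => [c _ /= [//]|].
have [c0 bc0] := proj b; have [c1 c0c1] := proj c0.
move=> /(_ (L c1)) []; split.
  by move=> a /= La; rewrite saL La dot0r.
suff <- : L c0 = L (L c1) by [].
have linB x y : L (x - y) = L x - L y.
  by rewrite addrC -scaleN1r linL scaleN1r addrC.
apply/eqP; rewrite -subr_eq0 -linB -(dnorm_eq0 (@dotC K n)).
by rewrite saL c0c1 //; eexists.
Qed.

(** * Closed subspaces of a Hilbert space *)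

Section Topology.
Context {K : realType} {V : normedModType K[i]}.

Lemma ball_rnorm (x y : V) (r : K) : ball x r%:C y <-> rnorm (x - y) < r.
Proof. by rewrite -ball_normE /ball_ /= rnormE ltcR. Qed.

Lemma closure_approx (S : set V) x (r : K) : closure S x ->
  0 < r -> exists2 s, S s & rnorm (x - s) < r.
Proof.
move=> Sx r0; have [|s [Ss xs]] := Sx (ball x r%:C); last first.
  by exists s => //; apply/ball_rnorm.
by apply: nbhsx_ballx; rewrite ltcR.
Qed.

End Topology.

Section Hilbert.
Context {K : realType} {X : completeNormedModType K[i]} (d : {dot X for conjC}).
Hypothesis nd : is_norm_of d.

Lemma parallelogram (x y : X) :
  rnorm (x + y) ^+ 2 + rnorm (x - y) ^+ 2 = 2 * rnorm x ^+ 2 + 2 * rnorm y ^+ 2.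
Proof.
have := rnormD_sq nd x y; have := rnormD_sq nd x (- y).
rewrite linearNr /= => -> ->.
have -> : rnorm (- y) = rnorm y by rewrite /rnorm normrN.
rewrite raddfN /=; lra.
Qed.

(** The projection theorem. The sets B e of vectors of W whose squared distance to
h is within e of the infimum generate a filter, which is Cauchy by the
parallelogram law; its limit q is in W. If w is in B (r^2) then, by
[rnorm_residual], moving w along v cannot reduce the squared distance by r^2,
hence |<h - w, v>| <= r |v|; letting w tend to q gives <h - q, v> = 0. *)
Lemma closed_subspace_decomposition (W : set X) : is_subspace W -> closed W ->
  forall h, exists2 q, W q & orth_compl d W (h - q).
Proof.
move=> sW cW h.
pose S : set K := [set rnorm (h - w) ^+ 2 | w in W].
have leS w : W w -> inf S <= rnorm (h - w) ^+ 2.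
  move=> Ww; apply: ge_inf; last by exists w.
  by exists 0 => _ [v _ <-]; exact: sqr_ge0.
pose B (e : K) : set X := [set w | W w /\ rnorm (h - w) ^+ 2 < inf S + e].
have B0 e : 0 < e -> exists w, B e w.
  move=> e0; have [|_ [w Ww <-] lt] := @inf_adherent _ S e e0; last by exists w.
  split; first by exists (rnorm (h - 0) ^+ 2), 0 => //; exact: sW.1.
  by exists 0 => _ [v _ <-]; exact: sqr_ge0.
pose F : set_system X := filter_from [set e : K | 0 < e] B.
have FF : ProperFilter F.
  apply: filter_from_proper; last by move=> e /B0.
  apply: filter_from_filter; first by exists 1 => /=.
  move=> e1 e2 /= e10 e20; exists (Num.min e1 e2); first by rewrite /= lt_min e10.
  by move=> w [Ww]; rewrite -ltrBlDl lt_min !ltrBlDl => /andP[? ?].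
have near_min e w w' : B e w -> B e w' -> rnorm (w - w') ^+ 2 <= 4 * e.
  move=> [Ww wE] [Ww' wE'].
  have := parallelogram (h - w) (h - w').
  have -> : h - w - (h - w') = w' - w by rewrite opprB addrC addrA subrK.
  have -> : h - w + (h - w') = 2%:C *: (h - 2^-1%:C *: (w + w')).
    rewrite scalerBr scalerA -rmorphM /= mulfV ?pnatr_eq0 // scale1r.
    have -> : 2%:C *: h = h + h by rewrite rmorph_nat scaler_nat mulr2n.
    by rewrite addrACA opprD.
  rewrite rnormZ // (rnormB w' w) exprMn.
  have := leS _ (subspaceZ sW 2^-1%:C (subspaceD sW Ww Ww')).
  lra.
have FC : cauchy F.
  apply: cauchy_exP => e e0.
  have [r r0 ->] : exists2 r : K, 0 < r & e = r%:C.
    exists (complex.Re e); last by rewrite RRe_real // gtr0_real.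
    by move: e0; rewrite ltcE /= => /andP[].
  have r20 : 0 < r ^+ 2 / 8 by rewrite divr_gt0 // exprn_gt0.
  have [x Bx] := B0 _ r20; exists x, (r ^+ 2 / 8) => //= y By.
  apply/ball_rnorm; rewrite -(@ltr_pXn2r _ 2) ?nnegrE ?rnorm_ge0 ?ltW //.
  apply: le_lt_trans (near_min _ _ _ Bx By) _.
  have : 0 < r ^+ 2 by rewrite exprn_gt0.
  lra.
have /= Fq := @cauchy_cvg X F FF FC; set q := lim F in Fq.
have near_q e r : 0 < e -> 0 < r -> exists2 w, B e w & rnorm (q - w) < r.
  move=> e0 r0; have Fb : F (ball q r%:C).
    by apply: Fq; apply: nbhsx_ballx; rewrite ltcR.
  have [|w [Bw /ball_rnorm qw]] := @filter_ex _ F FF (B e `&` ball q r%:C);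
    last by exists w.
  by apply: filterI => //; exists e.
exists q.
  apply: cW => N /Fq FN.
  have [|w [[Ww _] Nw]] := @filter_ex _ F FF (B 1 `&` N); last by exists w.
  by apply: filterI => //; exists 1 => /=.
move=> v Wv; apply: rnorm_eq0; apply/le_anti; rewrite rnorm_ge0 andbT.
apply/ler_addgt0Pr => e e0; rewrite add0r.
pose r := e / (2 * (rnorm v + 1)).
have v1 : 0 < rnorm v + 1 by rewrite ltr_wpDl ?rnorm_ge0.
have r0 : 0 < r by rewrite divr_gt0 // mulr_gt0.
have [w [Ww wE] qw] := near_q (r ^+ 2) r (exprn_gt0 _ r0) r0.
have hw : rnorm (d (h - w) v) <= r * rnorm v.
  rewrite -(@ler_pXn2r _ 2) ?nnegrE ?rnorm_ge0 ?(mulr_ge0 (ltW r0)) ?rnorm_ge0 //.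
  have := rnorm_residual nd (h - w) v.
  set a := _ / _.
  have -> : h - w - a *: v = h - (w + a *: v) by rewrite opprD addrA.
  have aE := leS _ (subspaceD sW Ww (subspaceZ sW a Wv)).
  move=> E.
  have -> : rnorm (d (h - w) v) ^+ 2 =
      (rnorm (h - w) ^+ 2 - rnorm (h - (w + a *: v)) ^+ 2) * rnorm v ^+ 2.
    by rewrite mulrBl E subKr.
  by rewrite [leRHS]exprMn ler_wpM2r ?sqr_ge0 //; lra.
have -> : h - q = (h - w) - (q - w) by rewrite opprB addrA subrK.
rewrite dotBl; apply: le_trans (rnormD _ _) _.
have -> : rnorm (- d (q - w) v) = rnorm (d (q - w) v) by rewrite /rnorm normrN.
apply: (@le_trans _ _ (r * rnorm v + r * rnorm v)).
  apply: lerD => //; apply: le_trans (cauchy_schwarz nd _ _) _.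
  by rewrite ler_wpM2r ?rnorm_ge0 // ltW.
have -> : e = 2 * r * (rnorm v + 1).
  by rewrite /r; field; rewrite gt_eqF.
have := rnorm_ge0 v; nra.
Qed.
End Hilbert.

(** The case of interest is the residual e of an oblique projection along the
orthogonal complement of a subspace that contains p, the projection of t. Put
r = |t - p|. Then Re <e, t> = Re <e, t - p> >= - |e| r, and c |t| <= |p| gives
c^2 |t|^2 <= |t|^2 - r^2, so that |e + t|^2 - c^2 |e|^2, multiplied by 1 - c^2,
dominates the square of (1 - c^2) |e| - r. For c = 1 one has r = 0 instead. *)
Lemma oblique_residual_le (K : realType) (V : normedModType K[i])
    (d : {dot V for conjC}) (nd : is_norm_of d) (c : K) (e t p : V) :
  0 <= c <= 1 -> d e p = 0 -> d (t - p) p = 0 -> c * rnorm t <= rnorm p ->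
  c * rnorm e <= rnorm (e + t).
Proof.
move=> /andP[c0 c1] ep tp ctp.
have tE := pythagoras nd tp; rewrite subrK in tE.
have etE := rnormD_sq nd e t.
have := Re_dot_le nd e (t - p); rewrite dotBr ep subr0 ler_norml => /andP[+ _].
move: (rnorm_ge0 e) (rnorm_ge0 t) (rnorm_ge0 p) (rnorm_ge0 (t - p)) ctp tE etE.
move: (rnorm_ge0 (e + t)).
move: (rnorm (e + t)) (rnorm e) (rnorm t) (rnorm p) (rnorm (t - p)) (complex.Re _).
move=> S a b q r m S0 a0 b0 q0 r0 cbq bE SE mE.
rewrite -(@ler_pXn2r _ 2) ?nnegrE ?mulr_ge0 // exprMn SE.
have cb2 : c ^+ 2 * b ^+ 2 <= q ^+ 2.
  by rewrite -exprMn ler_pXn2r ?nnegrE ?mulr_ge0.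
rewrite bE mulrDr in cb2.
have [k0|k0] := eqVneq (1 - c ^+ 2) 0.
  have c2 : c ^+ 2 = 1 by lra.
  rewrite c2 in cb2 *.
  have r2 : r ^+ 2 = 0 by apply/le_anti; rewrite sqr_ge0 andbT; lra.
  have r00 : r = 0 by apply/eqP; rewrite -sqrf_eq0 r2.
  rewrite r00 in mE bE; have := sqr_ge0 b; nra.
have k_gt0 : 0 < 1 - c ^+ 2 by rewrite lt_def k0 subr_ge0 expr_le1.
suff : 0 <= (1 - c ^+ 2) * (a ^+ 2 + b ^+ 2 + 2 * m - c ^+ 2 * a ^+ 2).
  by rewrite pmulr_rge0 // subr_ge0.
apply: (@le_trans _ _ (((1 - c ^+ 2) * a - r) ^+ 2)); first exact: sqr_ge0.
rewrite bE.
have km : 0 <= (1 - c ^+ 2) * (m + a * r) by rewrite mulr_ge0 ?(ltW k_gt0) //; lra.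
lra.
Qed.

(** * Norms of orthonormal expansions *)

Section OrthonormalNorm.
Context {K : realType}.

Lemma synth_rnorm_le (V V' : normedModType K[i]) (d : {dot V for conjC})
    (d' : {dot V' for conjC}) (e : nat -> V) (e' : nat -> V') (s : K) n
    (b c : 'rV[K[i]]_n) :
  is_norm_of d -> is_norm_of d' ->
  (forall i j, d (e i) (e j) = (i == j)%:R) ->
  (forall i j, d' (e' i) (e' j) = (i == j)%:R) ->
  0 <= s -> (forall k, rnorm (b 0 k) <= s * rnorm (c 0 k)) ->
  rnorm (synth e b) <= s * rnorm (synth e' c).
Proof.
move=> nd nd' on on' s0 bc.
rewrite -(@ler_pXn2r _ 2) ?nnegrE ?mulr_ge0 ?rnorm_ge0 // exprMn -lecR.
rewrite (rmorphM _ (s ^+ 2)) /=.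
rewrite -(dot_rnorm nd) -(dot_rnorm nd') !dot_synth !synth_adjK // !dotCE mulr_sumr.
apply: ler_sum => k _; rewrite -!normCK !rnormE -!rmorphXn -rmorphM /= lecR -exprMn.
by rewrite ler_pXn2r ?nnegrE ?mulr_ge0 ?rnorm_ge0.
Qed.

Lemma bessel (V : normedModType K[i]) (d : {dot V for conjC}) (e : nat -> V) n x :
  is_norm_of d -> (forall i j, d (e i) (e j) = (i == j)%:R) ->
  rnorm (synth e (synth_adj d e n x)) <= rnorm x.
Proof.
move=> nd on; set p := synth e _.
have xp : d (x - p) p = 0 by apply: orth_spanN_residual => //; eexists.
have := pythagoras nd xp; rewrite subrK => xE.
rewrite -(@ler_pXn2r _ 2) ?nnegrE ?rnorm_ge0 // xE.
by rewrite lerDr sqr_ge0.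
Qed.
End OrthonormalNorm.

(** * The two reconstruction steps as oblique projections *)

Section Reconstruction.
Context {K : realType} {X : normedModType K[i]} (d : {dot X for conjC}).
Hypothesis nd : is_norm_of d.

Lemma frame_opE (psi : nat -> X) R h :
  frame_op d psi R h = synth psi (synth_adj d psi R h).
Proof.
by rewrite synth_adjE /frame_op /synth; apply: eq_bigr => j _; rewrite mxE.
Qed.

Lemma frame_op_sym (psi : nat -> X) R x y :
  d (frame_op d psi R x) y = d x (frame_op d psi R y).
Proof. by rewrite !frame_opE dot_synth dot_synthr. Qed.

(** The normal equations of [g_rec] say U_N^* S S^* (y - w) = 0 with S = S_R, and
S S^* is symmetric. The matrix U_N^* S S^* U_N is invertible because a vector of
its kernel gives a vector of U_N orthogonal to S_R(U_N), hence of projection 0; the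
positive cosine forces it to vanish. *)
Lemma g_rec_spec (u psi : nat -> X) N R y :
  (forall i j, d (u i) (u j) = (i == j)%:R) ->
  let W := frame_op d psi R @` spanN u N in
  0 < cos (subspace_angle d (spanN u N) W) ->
  spanN u N (g_rec d u psi N R y) /\ orth_compl d W (y - g_rec d u psi N R y).
Proof.
move=> on W c0; rewrite /g_rec; split; first by eexists.
set L := (_ \o _); set b := op_inv _ _.
have linL : linear L by move=> a x x'; rewrite /L /= !linearP.
have L0 b' : L b' = 0 -> b' = 0.
  move=> Lb.
  have {}Lb :
    synth_adj d u N (synth psi (synth_adj d psi R (synth u b'))) = 0 := Lb.
  apply: (can_inj (synth_adjK on (n := N))); rewrite linear0.
  have : rnorm (synth u b') <= 0.
    rewrite -(pmulr_rle0 _ c0) -(@rnorm0 _ X).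
    apply: cos_angle_le => //; [exact: spanN_subspace|by eexists|].
    move=> _ [_ [c _ <-] <-]; rewrite dotBl dot0l sub0r -frame_op_sym.
    by rewrite dot_synthr frame_opE Lb dot0l oppr0.
  by move=> h; apply: rnorm_eq0; apply/le_anti; rewrite h rnorm_ge0.
have := op_invK linL L0 (synth_adj d u N (synth psi (synth_adj d psi R y))).
rewrite -/b /L /= => E _ [_ [c _ <-] <-].
by rewrite -frame_op_sym dot_synthr frame_opE !linearB /= E subrr dot0l.
Qed.

(** The vector obtained from the singular coefficients b, before b is specialized
to Sigma_N^-1 U_N^* applied to the first-stage reconstruction. *)
Definition frame_rec (v phi : nat -> X) N M (b : 'rV[K[i]]_N) : X :=
  let V := synth v (n := N) in let Vs := synth_adj d v N in
  let T := synth phi (n := M) in let Ts := synth_adj d phi M in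
  T (moore_penrose (@dotC K M) (@dotC K M) (Ts \o V \o Vs \o T) (Ts (V b))).

(** With L = T^* V V^* T and a the Moore-Penrose solution, the residual
r = T^* V b - L a is orthogonal to the range of the self-adjoint L, so <L r, r> = 0,
that is V^* T r = 0. But r = T^* V (b - V^* T a), so
|r|^2 = <b - V^* T a, V^* T r> = 0. Thus the normal equations hold exactly, even if
phi_1, ..., phi_M are linearly dependent. *)
Lemma frame_rec_spec (v phi : nat -> X) N M (b : 'rV[K[i]]_N) :
  (forall i j, d (v i) (v j) = (i == j)%:R) ->
  spanN phi M (frame_rec v phi M b) /\
  orth_compl d (orth_proj d (spanN v N) @` spanN phi M)
    (synth v b - frame_rec v phi M b).
Proof.
rewrite /frame_rec => on /=; set L := (_ \o _); set a := moore_penrose _ _ _ _.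
have linL : linear L by move=> c x x'; rewrite /L /= !linearP.
have saL c c' : dotC M (L c) c' = dotC M c (L c').
  rewrite /L /= -(dot_synthr d phi) dot_synth -(dot_synth d phi).
  by rewrite dot_synthr.
have := moore_penrose_selfadjoint linL saL (synth_adj d phi M (synth v b)).
rewrite -/a => La.
split; first by eexists.
set r := synth_adj d phi M (synth v b) - L a in La.
have rE : r = synth_adj d phi M (synth v (b - synth_adj d v N (synth phi a))).
  by rewrite /r /L /= !linearB.
have Vr : synth_adj d v N (synth phi r) = 0.
  have : dotC M (L r) r = 0 by rewrite saL La //; eexists.
  rewrite /L /= -(dot_synthr d phi) dot_synth => /eqP.
  by rewrite dnorm_eq0 => /eqP.
have r0 : r = 0.
  apply/eqP; rewrite -(dnorm_eq0 (@dotC K M)) {1}rE -dot_synthr dot_synth.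
  by rewrite Vr dot0r.
have Tr (x : 'rV_N) : d (synth v b - synth phi a) (synth v x) =
    d (synth v (b - synth_adj d v N (synth phi a))) (synth v x).
  by rewrite !dot_synthr !linearB /=; rewrite !(synth_adjK on).
move=> _ [_ [c _ <-] <-]; rewrite orth_proj_spanN // Tr dot_synth synth_adjK //.
by rewrite -dot_synth dot_synthr -rE r0 dot0l.
Qed.
End Reconstruction.

Section Errors.
Context {K : realType} {X : normedModType K[i]} (d : {dot X for conjC}).
Hypothesis nd : is_norm_of d.

Lemma g_rec_error (u psi : nat -> X) N R y y0 :
  (forall i j, d (u i) (u j) = (i == j)%:R) ->
  let theta := subspace_angle d (spanN u N) (frame_op d psi R @` spanN u N) in
  0 < cos theta -> spanN u N y0 ->
  rnorm (g_rec d u psi N R y - y0) <= sec theta * rnorm (y - y0).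
Proof.
move=> on theta c0 Uy0; rewrite /sec ler_pdivlMl //.
have [Uw yw] := g_rec_spec nd y on c0.
apply: cos_angle_le => //; [exact: spanN_subspace| |].
  exact: (subspaceB (spanN_subspace u N)).
by rewrite opprB addrA subrK.
Qed.

(** The comparison vector t' is the reconstruction from the exact coefficients
V^* x: it is the oblique projection of x itself, since x - P x is orthogonal to
P(T_M). *)
Lemma frame_rec_error (v phi : nat -> X) N M (b : 'rV[K[i]]_N) x :
  (forall i j, d (v i) (v j) = (i == j)%:R) ->
  let theta :=
    subspace_angle d (spanN phi M) (orth_proj d (spanN v N) @` spanN phi M) in
  0 < cos theta ->
  rnorm (x - frame_rec d v phi M b) <=
  sec theta * (rnorm (x - orth_proj d (spanN phi M) x) +
               rnorm (synth v (synth_adj d v N x) - synth v b)).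
Proof.
move=> on theta c0.
pose W := orth_proj d (spanN v N) @` spanN phi M.
have [Tt bt] := frame_rec_spec phi M b on.
have [Tt' xt'] := frame_rec_spec phi M (synth_adj d v N x) on.
move: (frame_rec d v phi M b) (frame_rec d v phi M (synth_adj d v N x))
  Tt Tt' bt xt' => t t' Tt Tt' bt xt'.
pose P y := synth v (synth_adj d v N y).
have PE y : orth_proj d (spanN v N) y = P y by rewrite orth_proj_spanN.
rewrite -/(P x) in xt' *.
have sT := spanN_subspace phi M.
have WV w : W w -> spanN v N w by move=> [s _ <-]; rewrite PE; eexists.
rewrite /sec mulrC ler_pdivlMr // mulrC.
apply: (@le_trans _ _ (cos theta * rnorm (x - t') + cos theta * rnorm (t' - t))).
  rewrite -mulrDr ler_wpM2l ?(ltW c0) //.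
  have -> : x - t = (x - t') + (t' - t) by rewrite addrA subrK.
  exact: rnormD.
apply: lerD; last first.
  apply: cos_angle_le => //; first exact: (subspaceB sT).
  move=> w Ww; have -> : P x - synth v b - (t' - t) = (P x - t') - (synth v b - t).
    by rewrite !opprB addrACA [RHS]addrACA [- t' - _]addrC.
  by rewrite dotBl xt' // bt // subrr.
have Tp : spanN phi M (orth_proj d (spanN phi M) x).
  by case: (orth_proj_cases d (spanN phi M) x) => [->|[]//]; exact: sT.1.
move: (orth_proj d (spanN phi M) x) Tp => p Tp.
have Ts' : spanN phi M (t' - p) := subspaceB sT Tt' Tp.
have -> : x - p = (x - t') + (t' - p) by rewrite addrA subrK.
have Ws : W (P (t' - p)) by exists (t' - p).
have Ps := orth_spanN_residual on (n := N) (t' - p).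
apply: (oblique_residual_le nd (p := P (t' - p))).
- by rewrite (ltW c0) cos_le1.
- have -> : x - t' = (x - P x) + (P x - t') by rewrite addrA subrK.
  by rewrite dotDl xt' // (orth_spanN_residual on) ?addr0 //; exact: WV.
- exact/Ps/WV.
- apply: cos_angle_le => // w Ww.
  have -> : P (t' - p) - (t' - p) = -1 *: (t' - p - P (t' - p)).
    by rewrite scaleN1r [RHS]opprB.
  by rewrite dotZl (Ps w (WV _ Ww)) mulr0.
Qed.
End Errors.

(** * Singular systems *)

Section SingularSystem.
Context {K : realType} {X : completeNormedModType K[i]} {Y : normedModType K[i]}.
Context {dX : {dot X for conjC}} {dY : {dot Y for conjC}}.
Hypotheses (normX : is_norm_of dX) (normY : is_norm_of dY).
Context {A : {linear X -> Y}} {sigma : nat -> K} {v : nat -> X} {u : nat -> Y}.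
Hypotheses (bndA : bounded_operator A) (sysA : singular_system dX dY A sigma v u).

Lemma singular_value_anti i j : (i <= j)%N -> sigma j <= sigma i.
Proof.
case: sysA => sig _ _ _ _ /subnK <-; elim: (j - i)%N => // k; apply: le_trans.
by have [] := sig (k + i)%N.
Qed.

(** Since sigma_k v_k is nonzero, it is not the default value of [adjoint_op], so
it does represent the functional x |-> <A x, u_k>. *)
Lemma dot_singular x k : dY (A x) (u k) = (sigma k)%:C * dX x (v k).
Proof.
case: sysA => sig [on _] _ _ /(_ k).
rewrite /adjoint_op; case: xgetP => [p _ h pE|_ /esym/eqP].
  by rewrite h pE dotZr conj_Creal // complex_real.
rewrite scaler_eq0 => /orP[|/eqP vk0].
  by rewrite fmorph_eq0 gt_eqF; have [] := sig k.
by have := on k k; rewrite vk0 dot0l eqxx => /esym/eqP; rewrite oner_eq0.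
Qed.

Lemma singular_synth n (b : 'rV[K[i]]_n) :
  A (synth v b) = synth u (\row_k ((sigma k)%:C * b 0 k)).
Proof.
case: sysA => _ _ _ Av _; rewrite /synth linear_sum; apply: eq_bigr => k _.
by rewrite linearZ /= Av scalerA mxE mulrC.
Qed.

Lemma nullsp_subspace : is_subspace (nullsp A).
Proof.
split => [|a x y /= Ax Ay]; rewrite /nullsp /= ?linear0 //.
by rewrite linearP Ax Ay scaler0 addr0.
Qed.

Lemma bounded_operator_ge0 :
  exists2 B : K, 0 <= B & forall x, rnorm (A x) <= B * rnorm x.
Proof.
have [B AB] := bndA; exists `|B| => // x; apply: le_trans (AB x) _.
by rewrite ler_wpM2r ?rnorm_ge0 // ler_norm.
Qed.

Lemma nullsp_closed : closed (nullsp A).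
Proof.
move=> x Nx; have [B B0 AB] := bounded_operator_ge0.
apply: rnorm_eq0; apply/le_anti; rewrite rnorm_ge0 andbT.
apply/ler_addgt0Pr => e e0; rewrite add0r.
have B1 : 0 < B + 1 by rewrite ltr_wpDl.
have [w Aw xw] := closure_approx Nx (divr_gt0 e0 B1).
have -> : A x = A (x - w) by rewrite linearB /= (Aw : A w = 0) subr0.
apply: le_trans (AB _) _; move: xw; rewrite ltr_pdivlMr //.
have := rnorm_ge0 (x - w); nra.
Qed.

(** Split h = p + q with q in N(A) and p _|_ N(A); then A h = A p, and p is a limit
of finite combinations of the v_k. The best approximation p' of p by such a
combination has no component along v_1, ..., v_N, so |A p'| <= sigma_N |p'|, and the
boundedness of A lets p' tend to p. *)
Lemma singular_tail_le N h : (0 < N)%N -> (forall k, (k < N)%N -> dX h (v k) = 0) ->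
  rnorm (A h) <= sigma N.-1 * rnorm h.
Proof.
move=> N0 hv; case: (sysA) => sig [onv clv] [onu _] _ _.
have [q Aq hq] :=
  closed_subspace_decomposition normX nullsp_subspace nullsp_closed h.
set p := h - q in hq; have hE : h = p + q by rewrite subrK.
have qv k : dX q (v k) = 0.
  have := dot_singular q k; rewrite (Aq : A q = 0) dot0l => /esym/eqP.
  rewrite mulf_eq0 fmorph_eq0 gt_eqF; last by have [] := sig k.
  by move=> /eqP.
have pv k : (k < N)%N -> dX p (v k) = 0 by move=> kN; rewrite dotBl hv // qv subrr.
have ph : rnorm p <= rnorm h.
  have := pythagoras normX (hq _ Aq); rewrite -hE => E.
  by rewrite -(@ler_pXn2r _ 2) ?nnegrE ?rnorm_ge0 // E lerDl sqr_ge0.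
have -> : A h = A p by rewrite hE linearD /= (Aq : A q = 0) addr0.
have [B B0 AB] := bounded_operator_ge0; have B1 : 0 < B + 1 by rewrite ltr_wpDl.
apply/ler_addgt0Pr => e e0.
have clp : closure (\bigcup_n spanN v n) p by rewrite clv.
have [w [n _ vw] pw] := closure_approx clp (divr_gt0 e0 B1).
pose p' := synth v (synth_adj dX v n p).
have pp' : rnorm (p - p') <= rnorm (p - w).
  have p'w : spanN v n (p' - w).
    by apply: (subspaceB (spanN_subspace v n)) => //; eexists.
  have := pythagoras normX (orth_spanN_residual onv p p'w).
  rewrite addrA subrK => E.
  by rewrite -(@ler_pXn2r _ 2) ?nnegrE ?rnorm_ge0 // E lerDl sqr_ge0.
have s0 : 0 <= sigma N.-1 by have [/ltW] := sig N.-1.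
have Ap' : rnorm (A p') <= sigma N.-1 * rnorm h.
  apply: le_trans (ler_wpM2l s0 (le_trans (bessel n p normX onv) ph)).
  rewrite singular_synth; apply: (synth_rnorm_le normY normX) => // k.
  rewrite !mxE synth_adjE mxE.
  have [kN|Nk] := ltnP k N; first by rewrite pv // mulr0 !rnorm0 mulr0.
  rewrite /rnorm normrM !rnormE -rmorphM /= ler_wpM2r ?rnorm_ge0 //.
  rewrite /rnorm ger0_norm /= ?ler0c; last by have [/ltW] := sig k.
  by apply: singular_value_anti; rewrite (leq_trans (leq_pred _)).
have -> : A p = A p' + A (p - p') by rewrite -linearD /= addrC subrK.
apply: le_trans (rnormD _ _) _; apply: lerD => //.
apply: le_trans (AB _) _; move: pw pp'; rewrite ltr_pdivlMr //.
have := rnorm_ge0 (p - p'); have := rnorm_ge0 (p - w); nra.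
Qed.

(** Up to sign, the k-th coefficient of P f - V b is that of the first-stage error
divided by sigma_k, hence at most 1 / sigma_N times it. As U_N U_N^* A f = A P f is in U_N,
[g_rec_error] bounds that error by sec(theta) |A (f - P f) + z|. *)
Lemma singular_coef_error N (psi : nat -> Y) R f z : (0 < N)%N ->
  let theta := subspace_angle dY (spanN u N) (frame_op dY psi R @` spanN u N) in
  0 < cos theta ->
  rnorm (synth v (synth_adj dX v N f) -
         synth v (synth_adj dY u N (g_rec dY u psi N R (A f + z))
                  *m invmx (Sigma_mx sigma N)))
  <= sec theta * (rnorm (f - orth_proj dX (spanN v N) f) + rnorm z / sigma N.-1).
Proof.
move=> N0 theta c0; case: (sysA) => sig [onv _] [onu _] _ _.
rewrite orth_proj_spanN //.
set P := synth v _; set w := g_rec _ _ _ _ _ _; set b := _ *m _.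
pose y0 := synth u (synth_adj dY u N (A f)).
have sN : 0 < sigma N.-1 by have [] := sig N.-1.
have AP : A P = y0.
  rewrite singular_synth /y0; congr synth; apply/rowP => k.
  by rewrite !synth_adjE !mxE dot_singular.
have wy0 : rnorm (w - y0) <= sec theta * (sigma N.-1 * rnorm (f - P) + rnorm z).
  apply: le_trans (g_rec_error normY _ onu c0 _) _; first by eexists.
  rewrite ler_wpM2l ?invr_ge0 ?(ltW c0) //.
  rewrite -AP addrAC -linearB /=; apply: le_trans (rnormD _ _) _.
  rewrite lerD2r; apply: singular_tail_le => // k kN.
  apply: (orth_spanN_residual onv); exists (delta_mx 0 (Ordinal kN)) => //.
  rewrite /synth (bigD1 (Ordinal kN)) //= mxE !eqxx scale1r big1 ?addr0 //.
  by move=> i ik; rewrite mxE (negPf ik) andbF scale0r.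
have bE (k : 'I_N) : (sigma k)%:C * b 0 k = dY w (u k).
  have : (b *m Sigma_mx sigma N) 0 k = synth_adj dY u N w 0 k.
    rewrite /b mulmxKV // /Sigma_mx unitmxE det_diag unitfE.
    by apply/prodf_neq0 => i _; rewrite mxE fmorph_eq0 gt_eqF //; have [] := sig i.
  by rewrite /Sigma_mx mul_mx_diag !mxE synth_adjE mxE mulrC.
move: b bE => b bE.
have : rnorm (synth v (synth_adj dX v N f - b)) <=
       (sigma N.-1)^-1 * rnorm (synth u (synth_adj dY u N (w - y0))).
  apply: (synth_rnorm_le normX normY) => // [|k]; first by rewrite invr_ge0 ltW.
  rewrite ler_pdivlMl //.
  apply: (@le_trans _ _ (rnorm ((sigma k)%:C * (synth_adj dX v N f - b) 0 k))).
    rewrite {2}/rnorm normrM !rnormE -rmorphM /= ler_wpM2r ?rnorm_ge0 //.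
    rewrite /rnorm ger0_norm /= ?ler0c; last by have [/ltW] := sig k.
    by apply: singular_value_anti; rewrite -ltnS prednK.
  rewrite !synth_adjE !mxE mulrBr bE -dot_singular dotBl.
  rewrite rnormB le_eqVlt; apply/orP; left; apply/eqP; congr (rnorm (_ - _)).
  have := synth_adjK onu (synth_adj dY u N (A f)); rewrite -/y0.
  by rewrite !synth_adjE => /rowP /(_ k); rewrite !mxE.
rewrite linearB /= -/P => H; apply: (le_trans H).
rewrite ler_pdivrMl //.
apply: le_trans (bessel _ _ normY onu) _; apply: le_trans wy0 _.
rewrite mulrCA ler_wpM2l ?invr_ge0 ?(ltW c0) // mulrDr mulrCA mulfV ?gt_eqF //.
by rewrite mulr1.
Qed.
End SingularSystem.

(** * The error estimate *)

Theorem mainTheorem3 (K : realType) (X Y : completeNormedModType K[i])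
    (dX : {dot X for conjC}) (dY : {dot Y for conjC})
    (normX : is_norm_of dX) (normY : is_norm_of dY)
    (sepX : separable_space X) (sepY : separable_space Y)
    (A : {linear X -> Y})
    (bndA : bounded_operator A) (cptA : compact_operator A)
    (sigma : nat -> K) (v : nat -> X) (u : nat -> Y)
    (sysA : singular_system dX dY A sigma v u)
    (psi : nat -> Y)
    (psi_frame : is_frame dY (orth_compl dY (nullsp (adjoint_op dX dY A))) psi)
    (phi : nat -> X) (phi_frame : is_frame dX (orth_compl dX (nullsp A)) phi)
    (f : X) (z : Y) (delta : K) (z_le : rnorm z <= delta)
    (N M R : nat) (N_gt0 : (0 < N)%N) (M_gt0 : (0 < M)%N) (R_gt0 : (0 < R)%N) :
  let g := A f in
  let fdag := moore_penrose dX dY A g in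
  let VN := spanN v N in
  let UN := spanN u N in
  let TM := spanN phi M in
  let theta1 := subspace_angle dY UN (frame_op dY psi R @` UN) in
  let theta2 := subspace_angle dX TM (orth_proj dX VN @` TM) in
  0 < cos theta1 ->
  0 < cos theta2 ->
  rnorm (fdag - f_rec dX dY sigma v phi u psi N M R (g + z)) <=
    (1 + 2 * sec theta2) * rnorm (fdag - f)
    + sec theta2 * rnorm (fdag - orth_proj dX TM fdag)
    + sec theta2 * sec theta1 *
      (rnorm (f - orth_proj dX VN f) + delta / sigma N.-1).
Proof.
move=> g fdag VN UN TM theta1 theta2 c1 c2.
case: (sysA) => sig [onv _] [onu _] _ _.
have sN : 0 < sigma N.-1 by have [] := sig N.-1.
have coef := singular_coef_error normX normY bndA sysA f z N_gt0 c1.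
set y := g + z; set b := _ *m _ in coef.
have rec := frame_rec_error normX b fdag onv c2.
have sec1 : 0 <= sec theta1 by rewrite invr_ge0 ltW.
have sec2 : 0 <= sec theta2 by rewrite invr_ge0 ltW.
apply: (le_trans rec); rewrite -/TM -/theta2.
have proj : rnorm (synth v (synth_adj dX v N fdag) - synth v (synth_adj dX v N f))
            <= rnorm (fdag - f).
  by rewrite -linearB -linearB; exact: bessel.
have err : rnorm (synth v (synth_adj dX v N fdag) - synth v b) <=
    rnorm (fdag - f) +
    sec theta1 * (rnorm (f - orth_proj dX VN f) + delta / sigma N.-1).
  have -> : synth v (synth_adj dX v N fdag) - synth v b =
      (synth v (synth_adj dX v N fdag) - synth v (synth_adj dX v N f)) +
      (synth v (synth_adj dX v N f) - synth v b) by rewrite addrA subrK.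
  apply: le_trans (rnormD _ _) _; apply: lerD => //; apply: (le_trans coef).
  by rewrite ler_wpM2l // lerD2l ler_pM2r ?invr_gt0.
have := ler_wpM2l sec2 err.
have := rnorm_ge0 (fdag - f); have := mulr_ge0 sec2 (rnorm_ge0 (fdag - f)).
rewrite !mulrDr !mulrDl mulrA; lra.
Qed.
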